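(* Let $k\in(0,1)$, let $n\ge 1$ be an integer, and let $r_1,\dots,r_n$ be real numbers with $r_i\ge -1$ for all $i$ (the returns of $n$ successive trades). Let $R(n)=\prod_{i=1}^{n}(1-k)(1+r_i)$ be the cumulative return after $n$ trades with transaction cost rate $k$, and let $\bar r=\frac1n\sum_{i=1}^{n} r_i$. Then $$R(n)\le \left[(1-k)(1+\bar r)\right]^n .$$
   Context: A price series $S$ is given, with $S(t)$ the price at time $t$. The $i$-th trade buys at time $b_i$ and sells at time $s_i$, with $S(b_i)>0$ and $S(s_i)\ge 0$; its return is $r_i=\frac{S(s_i)-S(b_i)}{S(b_i)}$, so that $r_i\ge -1$. The transaction cost of the $i$-th trade is taken to be $T_i=k\,S(s_i)$, where the constant $k\in(0,1)$ is the transaction cost rate. The cumulative return after $n$ trades is $$R(n)=\prod_{i=1}^{n}\left(1+\frac{S(s_i)-S(b_i)-T_i}{S(b_i)}\right)=\prod_{i=1}^{n}(1-k)\frac{S(s_i)}{S(b_i)}=\prod_{i=1}^{n}(1-k)(1+r_i).$$ *)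

(* Defs.v *)
From mathcomp Require Import all_boot all_order all_algebra.
From mathcomp Require Import reals.

Set Implicit Arguments.
Unset Strict Implicit.
Unset Printing Implicit Defensive.

Import Order.TTheory GRing.Theory Num.Theory.
Local Open Scope ring_scope.

(* [k] is the transaction cost rate and [r i] the return of the i-th trade,
   trades being indexed from 0. The factor (1 - k) * (1 + r i) is
   1 + (S(s_i) - S(b_i) - k S(s_i)) / S(b_i) for a trade that buys at price
   S(b_i) and sells at price S(s_i), where r i = (S(s_i) - S(b_i)) / S(b_i). *)
Definition cumulative_return (R : realType) (k : R) (n : nat) (r : 'I_n -> R) : R :=
  \prod_(i < n) ((1 - k) * (1 + r i)).

Definition mean_return (R : realType) (n : nat) (r : 'I_n -> R) : R :=
  n%:R^-1 * \sum_(i < n) r i.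

(* Main.v *)
Require Import Defs.
From mathcomp Require Import all_boot all_order all_algebra.
From mathcomp Require Import reals.

Set Implicit Arguments.
Unset Strict Implicit.
Unset Printing Implicit Defensive.

Import Order.TTheory GRing.Theory Num.Theory.
Local Open Scope ring_scope.

(** This is AM-GM ([leif_AGM]) applied to the factors [(1 - k) * (1 + r i)], nonnegative since
    [k < 1] and [-1 <= r i]. Averaging is affine, so their arithmetic mean is exactly the base of
    the power on the right. *)

Theorem theorem1 (R : realType) (k : R) (hk0 : 0 < k) (hk1 : k < 1)
    (n : nat) (hn : (1 <= n)%N) (r : 'I_n -> R)
    (hr : forall i : 'I_n, -1 <= r i) :
  cumulative_return k r <= ((1 - k) * (1 + mean_return r)) ^+ n.
Proof.
have E_ge0 : {in 'I_n, forall i, 0 <= (1 - k) * (1 + r i)}.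
  by move=> i _; rewrite mulr_ge0 ?subr_ge0 ?(ltW hk1) // addrC -lerBlDr sub0r.
have n_neq0 : n%:R != 0 :> R by rewrite pnatr_eq0 -lt0n.
have mean1D : (\sum_(i < n) (1 + r i)) / n%:R = 1 + mean_return r.
  by rewrite big_split sumr_const card_ord mulrDl divff // mulrC.
(* [leif_AGM] also characterises equality; [.1] keeps only the inequality, with exponent
   [#|'I_n|]. *)
have := (leif_AGM E_ge0).1.
by rewrite card_ord -mulr_sumr -mulrA mean1D.
Qed.
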